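(* Let $k$ be a field of characteristic zero, let $n\ge 2$, $d\ge 2$, $m\ge 1$, $e\ge 1$ be integers, and let $$P(X,S)=S^{d}+f_{d-1}(X)S^{d-1}+\cdots+f_{1}(X)S+f_{0}(X),\qquad Q(X,Y)=Y^{m}+g_{m-1}(X)Y^{m-1}+\cdots+g_{1}(X)Y+g_{0}(X)$$ with $f_i,g_j\in k[X]$. Let $$R=k[X,Y,Z]/\left\langle X^{n}Y-P\left(X,\,Q(X,Y)-X^{e}Z\right)\right\rangle ,$$ let $x,y,z$ be the images of $X,Y,Z$ in $R$, let $s=Q(x,y)-x^{e}z$, and let $\partial$ be the locally nilpotent $k$-derivation of $R$ given by $$\partial(x)=0,\qquad \partial(y)=x^{e}\frac{\partial P}{\partial S}(x,s),\qquad \partial(z)=\frac{\partial Q}{\partial Y}(x,y)\,\frac{\partial P}{\partial S}(x,s)-x^{n}.$$ Then: (1) $\mathrm{ML}(R)=k[x]$. Consequently $R$ is semi-rigid. (2) Every $D\in\mathrm{LND}(R)$ has the form $D=f(x)\partial$ with $f(x)\in k[x]$; that is, $R$ is almost rigid.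
   Context: For a commutative domain $B$ over a field $k$ of characteristic zero, a $k$-derivation $\partial$ of $B$ is locally nilpotent if for every $a\in B$ there is $N\ge 0$ with $\partial^{N}(a)=0$; $\mathrm{LND}(B)$ is the set of locally nilpotent $k$-derivations of $B$. The Makar-Limanov invariant is $\mathrm{ML}(B)=\bigcap_{D\in\mathrm{LND}(B)}\ker D$. For $\partial\in\mathrm{LND}(B)$, $\deg_\partial(a)=\min\{i\in\mathbb{N}\mid \partial^{i+1}(a)=0\}$ for $a\neq 0$ and $\deg_\partial(0)=-\infty$. $B$ is semi-rigid if all non-zero $\partial\in\mathrm{LND}(B)$ induce the same degree function $\deg_\partial$ (equivalently, the same filtration). $B$ is almost rigid if $\mathrm{LND}(B)=\ker(\partial)\cdot\partial$ for some non-zero $\partial\in\mathrm{LND}(B)$. *)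

(* Defs.v *)
From HB Require Import structures.
From mathcomp Require Import all_boot all_order all_algebra.
From mathcomp Require Import generic_quotient ring_quotient boolp mpoly.

Set Implicit Arguments.
Unset Strict Implicit.
Unset Printing Implicit Defensive.

Import GRing.Theory.
Local Open Scope ring_scope.
Local Open Scope quotient_scope.

Section LocallyNilpotent.
Variables (k : fieldType) (B : comAlgType k).
Implicit Types (D E : B -> B) (a b : B).

Definition domain : Prop :=
  (1 : B) <> 0 /\ forall a b, a * b = 0 -> a = 0 \/ b = 0.

Record derivation D : Prop := Derivation {
  derivation_linear : linear D;
  derivation_leibniz : forall a b, D (a * b) = D a * b + a * D b }.

Record is_lnd D : Prop := IsLnd {
  lnd_derivation : derivation D;
  lnd_nilpotent : forall a, exists N, iter N D a = 0 }.

Definition nonzero D : Prop := exists a, D a <> 0.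

Definition ML a : Prop := forall D, is_lnd D -> D a = 0.

Lemma lnd_deg_subproof D (lndD : is_lnd D) a : exists i, iter i.+1 D a == 0.
Proof.
have [N DN] := lnd_nilpotent lndD a; exists N.
rewrite iterS DN; apply/eqP.
by have := derivation_linear (lnd_derivation lndD) (- 1) 0 0;
   rewrite !scaleN1r oppr0 addr0 addNr.
Qed.

(* [None] stands for the degree -oo of 0. *)
Definition lnd_deg D (lndD : is_lnd D) a : option nat :=
  if a == 0 then None else Some (ex_minn (lnd_deg_subproof lndD a)).

(* Both rigidity notions only make sense for domains, so they include
   integrality of B. *)
Definition semi_rigid : Prop :=
  domain /\
  forall D E (lndD : is_lnd D) (lndE : is_lnd E), nonzero D -> nonzero E ->
    lnd_deg lndD =1 lnd_deg lndE.

Definition almost_rigid : Prop :=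
  domain /\
  exists E, [/\ is_lnd E, nonzero E &
    forall D, is_lnd D <-> exists2 c, E c = 0 & D =1 (fun b => c * E b)].

End LocallyNilpotent.

Arguments domain {k} B.
Arguments ML {k} B a.
Arguments semi_rigid {k} B.
Arguments almost_rigid {k} B.

(* The value P(a, b) of P(X, T) in k[X][T]; thus P^`() is the partial
   derivative of P in its second variable T. *)
Definition eval2 (k : fieldType) (A : comAlgType k)
    (P : {poly {poly k}}) (a b : A) : A :=
  (map_poly (horner_alg a) P).[b].

Section Ring.
Variables (k : fieldType) (n e : nat) (P Q : {poly {poly k}}).

Definition varX : {mpoly k[3]} := 'X_(@Ordinal 3 0 isT).
Definition varY : {mpoly k[3]} := 'X_(@Ordinal 3 1 isT).
Definition varZ : {mpoly k[3]} := 'X_(@Ordinal 3 2 isT).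

Definition rel_poly : {mpoly k[3]} :=
  varX ^+ n * varY - eval2 P varX (eval2 Q varX varY - varX ^+ e * varZ).

Definition rel_ideal : {pred {mpoly k[3]}} :=
  fun p => `[< exists q, p = q * rel_poly >].

Fact rel_ideal_zmod : zmod_closed rel_ideal.
Proof.
split=> [|p q /asboolP[p' ->] /asboolP[q' ->]]; apply/asboolP.
  by exists 0; rewrite mul0r.
by exists (p' - q'); rewrite mulrBl.
Qed.

HB.instance Definition _ :=
  GRing.isZmodClosed.Build {mpoly k[3]} rel_ideal rel_ideal_zmod.

Lemma eval2_meval (v : 'I_3 -> k) (U : {poly {poly k}}) (a b : {mpoly k[3]}) :
  (eval2 U a b).@[v] = (map_poly (horner_eval a.@[v]) U).[b.@[v]].
Proof.
rewrite /eval2 -horner_map -map_poly_comp; congr _.[_].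
apply: eq_map_poly => p /=; rewrite /horner_alg /horner_morph -horner_map.
rewrite -map_poly_comp /horner_eval; congr _.[_].
by apply: map_poly_id => c _ /=; rewrite mevalZ meval1 mulr1.
Qed.

(* The relation vanishes at (1, P(1, 0), Q(1, P(1, 0))), so that it generates
   a proper ideal for all values of the parameters. *)
Fact rel_ideal_proper :
  1 \notin rel_ideal /\ (forall p, {in rel_ideal, forall q, p * q \in rel_ideal}).
Proof.
split=> [|p q /asboolP[q' ->]]; last first.
  by apply/asboolP; exists (p * q'); rewrite mulrA.
apply/negP => /asboolP[q].
pose y : k := (map_poly (horner_eval 1) P).[0].
pose v (i : 'I_3) : k := nth 0 [:: 1; y; (map_poly (horner_eval 1) Q).[y]] i.
move=> /(congr1 (meval v)); rewrite meval1 mevalM /rel_poly.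
rewrite mevalB !eval2_meval mevalB !mevalM !rmorphXn !eval2_meval /= !mevalXU.
rewrite /v /= !expr1n !mul1r subrr subrr mulr0.
by apply/eqP; rewrite oner_eq0.
Qed.

HB.instance Definition _ :=
  isProperIdeal.Build {mpoly k[3]} rel_ideal rel_ideal_proper.

Definition quo_ring : Type := {ideal_quot rel_ideal}.
HB.instance Definition _ := GRing.ComNzRing.on quo_ring.

Definition quo_pi (p : {mpoly k[3]}) : quo_ring :=
  \pi_({ideal_quot rel_ideal}) p.

Definition quo_scale (c : k) (a : quo_ring) : quo_ring := quo_pi c%:MP * a.

Fact quo_piM (p q : {mpoly k[3]}) : quo_pi (p * q) = quo_pi p * quo_pi q.
Proof. exact: (rmorphM \pi_({ideal_quot rel_ideal})). Qed.

Fact quo_piD (p q : {mpoly k[3]}) : quo_pi (p + q) = quo_pi p + quo_pi q.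
Proof. exact: (rmorphD \pi_({ideal_quot rel_ideal})). Qed.

Fact quo_pi1 : quo_pi 1 = 1.
Proof. exact: (rmorph1 \pi_({ideal_quot rel_ideal})). Qed.

Fact quo_scaleA c d a : quo_scale c (quo_scale d a) = quo_scale (c * d) a.
Proof. by rewrite /quo_scale mulrA -quo_piM mpolyCM. Qed.

Fact quo_scale1 : left_id 1 quo_scale.
Proof. by move=> a; rewrite /quo_scale mpolyC1 quo_pi1 mul1r. Qed.

Fact quo_scaleDr : right_distributive quo_scale +%R.
Proof. by move=> c a b; rewrite /quo_scale mulrDr. Qed.

Fact quo_scaleDl a : {morph quo_scale^~ a : c d / c + d}.
Proof. by move=> c d; rewrite /quo_scale mpolyCD quo_piD mulrDl. Qed.

HB.instance Definition _ := GRing.Zmodule_isLmodule.Build k quo_ring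
  quo_scaleA quo_scale1 quo_scaleDr quo_scaleDl.

Fact quo_scaleAl c (a b : quo_ring) : c *: (a * b) = c *: a * b.
Proof. by rewrite /GRing.scale /= /quo_scale mulrA. Qed.

HB.instance Definition _ := GRing.Lmodule_isLalgebra.Build k quo_ring quo_scaleAl.
HB.instance Definition _ := GRing.Lalgebra_isComAlgebra.Build k quo_ring.

End Ring.

(* Main.v *)
(* Write L = k[x, 1/x][s]. Inverting x solves the relations y = P(x, s) / x^n and
   z = (Q(x, y) - s) / x^e, so R embeds in L, and reducing s^d and y^m shows that
   R is free over k[x] on the z^q y^u s^t with u < m, t < d. These have pairwise
   distinct degrees j in s, with leading coefficient x^-(xden j); hence leading
   monomials x^i s^j of elements of R satisfy i >= - xden j.

   Order monomials by degree in s, then in x. A locally nilpotent D acts on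
   leading monomials by a shift (p, r) and a linear form l: where l does not
   vanish, the leading monomial of D u is that of u shifted by (p, r), and by
   nilpotence every orbit of the shift reaches a zero of l. If r >= 0 this
   contradicts the shape of the monomials of R as soon as n >= 2 and d >= 2;
   hence r = -1, which means D x = 0 and D s = c(x). The leading coefficient of
   D z then shows that x^(n+e) = partial s divides c(x), so D is a
   k[x]-multiple of partial. *)

Require Import Defs.
From HB Require Import structures.
From mathcomp Require Import all_boot all_order all_algebra.
From mathcomp Require Import generic_quotient ring_quotient boolp mpoly.
From mathcomp Require Import zify ring.

Set Implicit Arguments.
Unset Strict Implicit.
Unset Printing Implicit Defensive.

Import GRing.Theory.
Local Open Scope ring_scope.

(** * Leading monomials in k[X][S] *)

Section Bidegree.
Variable k : idomainType.
Implicit Types (w : {poly {poly k}}) (I J : nat).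

Lemma coefM_top (A : nzRingType) (p q : {poly A}) (i j : nat) :
  (size p <= i.+1)%N -> (size q <= j.+1)%N ->
  (p * q)`_(i + j) = p`_i * q`_j.
Proof.
move=> sp sq; rewrite coefM.
have lti : (i < (i + j).+1)%N by rewrite ltnS leq_addr.
rewrite (bigD1 (Ordinal lti)) //= addKn big1 ?addr0 // => l.
rewrite -val_eqE /= => nli; case: (ltnP i l) => il.
  by rewrite (nth_default _ (leq_trans sp il)) mul0r.
rewrite [q`__]nth_default ?mulr0 //; apply: leq_trans sq _.
by move: nli il (ltn_ord l); lia.
Qed.

Lemma size_mul_le (A : nzRingType) (p q : {poly A}) (i j : nat) :
  (size p <= i.+1)%N -> (size q <= j.+1)%N -> (size (p * q)%R <= (i + j).+1)%N.
Proof. by move=> sp sq; apply: leq_trans (size_polyMleq p q) _; lia. Qed.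

Lemma size_polyMn (A : nzRingType) (p : {poly A}) (c : nat) :
  (size (p *+ c)%R <= size p)%N.
Proof.
by apply/leq_sizeP => j /leq_sizeP pj; rewrite coefMn pj // mul0rn.
Qed.

(* The monomials of [w] are at most X^I S^J for the lexicographic order that
   compares exponents of S first. *)
Definition bideg_le w I J : Prop :=
  (size w <= J.+1)%N /\ (size (w`_J)%R <= I.+1)%N.

Definition bideg w I J : Prop := bideg_le w I J /\ w`_J`_I <> 0.

(** Leading monomials multiply for the lexicographic order. Either coefficient may vanish here, as
    happens in [exponent_der] when one of two summands has no top term. *)
Lemma bideg_leM w1 w2 I1 J1 I2 J2 :
  bideg_le w1 I1 J1 -> bideg_le w2 I2 J2 ->
  bideg_le (w1 * w2) (I1 + I2) (J1 + J2) /\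
  (w1 * w2)`_(J1 + J2)`_(I1 + I2) = w1`_J1`_I1 * w2`_J2`_I2.
Proof.
move=> [s1 t1] [s2 t2]; rewrite /bideg_le coefM_top //.
by split; [split; exact: size_mul_le | exact: coefM_top].
Qed.

Lemma bideg_leD w1 w2 I J : bideg_le w1 I J -> bideg_le w2 I J ->
  bideg_le (w1 + w2) I J.
Proof.
move=> [s1 t1] [s2 t2]; rewrite /bideg_le coefD.
by split; apply: leq_trans (size_polyD _ _) _; rewrite geq_max ?s1 ?t1.
Qed.

Lemma bidegM w1 w2 I1 J1 I2 J2 : bideg w1 I1 J1 -> bideg w2 I2 J2 ->
  bideg (w1 * w2) (I1 + I2) (J1 + J2).
Proof.
move=> [b1 /eqP c1] [b2 /eqP c2].
have [b c] := bideg_leM b1 b2.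
by split=> //; rewrite c; apply/eqP; rewrite mulf_neq0.
Qed.

Lemma bideg_size w I J : bideg w I J ->
  size w = J.+1 /\ size w`_J = I.+1.
Proof.
move=> [[sJ sI] nz]; split; apply/eqP; rewrite eqn_leq ?sJ ?sI /=.
  by rewrite ltnNge; apply/negP => /(nth_default 0) w0; apply: nz; rewrite w0 coef0.
by rewrite ltnNge; apply/negP => /(nth_default 0).
Qed.

Lemma bideg_uniq w I J I' J' : bideg w I J -> bideg w I' J' ->
  I = I' /\ J = J'.
Proof.
move=> /bideg_size[sJ sI] /bideg_size[sJ' sI'].
have eJ : J = J' by move: sJ; rewrite sJ' => -[].
by subst J'; move: sI; rewrite sI' => -[].
Qed.

Lemma bideg_neq0 w I J : bideg w I J -> w <> 0.
Proof. by move=> /bideg_size[+ _] => + w0; rewrite w0 size_poly0. Qed.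

Lemma bideg_monic w J : w \is monic -> size w = J.+1 -> bideg w 0 J.
Proof.
move=> /monicP wm sw; have lw : w`_J = 1 by rewrite -wm lead_coefE sw.
by split; [split|]; rewrite ?lw ?sw ?size_poly1 ?coef1 //; apply/eqP; rewrite oner_eq0.
Qed.

Lemma bidegXn (N : nat) : bideg ('X^N)%:P N 0.
Proof.
split; last by rewrite coefC eqxx coefXn eqxx; apply/eqP; rewrite oner_eq0.
by split; rewrite ?size_polyC_leq1 // coefC eqxx size_polyXn.
Qed.

Lemma bidegX : bideg 'X 0 1.
Proof. by apply: bideg_monic; rewrite ?monicX ?size_polyX. Qed.

Lemma bideg_exists w : w <> 0 -> exists I J, bideg w I J.
Proof.
move=> /eqP w0; have lw : lead_coef w != 0 by rewrite lead_coef_eq0.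
have sw : (size w).-1.+1 = size w by rewrite prednK // size_poly_gt0.
have sl : (size (lead_coef w)).-1.+1 = size (lead_coef w).
  by rewrite prednK // size_poly_gt0.
exists (size (lead_coef w)).-1, (size w).-1.
rewrite /bideg /bideg_le -lead_coefE sw sl; split=> //.
by rewrite -lead_coefE; apply/eqP; rewrite lead_coef_eq0.
Qed.

(** The place chosen is the larger of the two leading monomials. Applied to rescaled values of a
    derivation at [x] and [s], it makes the associated linear form non-zero. *)
Lemma bideg_exists2 w1 w2 : w1 <> 0 \/ w2 <> 0 ->
  exists I J, [/\ bideg_le w1 I J, bideg_le w2 I J &
    w1`_J`_I <> 0 \/ w2`_J`_I <> 0].
Proof.
move=> nz; pose J := (maxn (size w1) (size w2)).-1.
have sJ : (maxn (size w1) (size w2) = J.+1)%N.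
  rewrite /J prednK // leq_max !size_poly_gt0.
  by case: nz => /eqP ->; rewrite ?orbT.
have nzJ : w1`_J <> 0 \/ w2`_J <> 0.
  case: (leqP (size w1) (size w2)) sJ => [le12|lt21] sJ.
    have w2J : lead_coef w2 = w2`_J by rewrite lead_coefE sJ.
    by right; rewrite -w2J; apply/eqP; rewrite lead_coef_eq0 -size_poly_eq0 sJ.
  have w1J : lead_coef w1 = w1`_J by rewrite lead_coefE sJ.
  by left; rewrite -w1J; apply/eqP; rewrite lead_coef_eq0 -size_poly_eq0 sJ.
pose I := (maxn (size w1`_J) (size w2`_J)).-1.
have sI : (maxn (size (w1`_J)%R) (size (w2`_J)%R) = I.+1)%N.
  rewrite /I prednK // leq_max !size_poly_gt0.
  by case: nzJ => /eqP ->; rewrite ?orbT.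
exists I, J; rewrite /bideg_le -sJ -sI !leq_maxl !leq_maxr; split=> //.
case: (leqP (size w1`_J) (size w2`_J)) sI => [le12|lt21] sI.
  have w2I : lead_coef w2`_J = w2`_J`_I by rewrite lead_coefE sI.
  by right; rewrite -w2I; apply/eqP; rewrite lead_coef_eq0 -size_poly_eq0 sI.
have w1I : lead_coef w1`_J = w1`_J`_I by rewrite lead_coefE sI.
by left; rewrite -w1I; apply/eqP; rewrite lead_coef_eq0 -size_poly_eq0 sI.
Qed.

Lemma size_eulerX (p : {poly k}) : (size ('X * p^`())%R <= size p)%N.
Proof.
have [->|p0] := eqVneq p 0; first by rewrite linear0 mulr0.
apply: leq_trans (size_polyMleq _ _) _; rewrite size_polyX /=.
by apply: lt_size_deriv.
Qed.

Lemma coef_eulerX (A : nzRingType) (p : {poly A}) i :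
  ('X * p^`())`_i = p`_i *+ i.
Proof. by rewrite coefXM; case: i => [|i] //=; rewrite ?mulr0n // coef_deriv. Qed.

(** Euler operators are diagonal on monomials, with the exponents as eigenvalues; [bideg_le_eulerX]
    is the analogue for the inner variable. *)
Lemma bideg_le_eulerS w I J : bideg_le w I J ->
  bideg_le ('X * w^`()) I J /\ ('X * w^`())`_J`_I = w`_J`_I *+ J.
Proof.
move=> [sw sc]; rewrite /bideg_le coef_eulerX coefMn; split=> //; split.
  have [->|w0] := eqVneq w 0; first by rewrite linear0 mulr0 size_poly0.
  apply: leq_trans (size_polyMleq _ _) _; rewrite size_polyX /=.
  by apply: leq_trans (lt_size_deriv w0) sw.
by apply: leq_trans (size_polyMn _ _) sc.
Qed.

Lemma bideg_le_eulerX w I J : bideg_le w I J ->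
  bideg_le ('X%:P * map_poly (@deriv k) w) I J /\
  ('X%:P * map_poly (@deriv k) w)`_J`_I = w`_J`_I *+ I.
Proof.
move=> [sw sc]; rewrite /bideg_le mul_polyC coefZ coef_map_id0 ?linear0 //.
rewrite coef_eulerX; split=> //; split.
  by apply: leq_trans (size_scale_leq _ _) _; apply: leq_trans (size_poly _ _) sw.
by apply: leq_trans (size_eulerX _) sc.
Qed.

Lemma bideg_leMn w I J (c : nat) : bideg_le w I J -> bideg_le (w *+ c) I J.
Proof.
move=> [sw sc]; rewrite /bideg_le coefMn.
by split; apply: leq_trans (size_polyMn _ _) _.
Qed.

Lemma bideg_leN w I J : bideg_le w I J -> bideg_le (- w) I J.
Proof. by rewrite /bideg_le coefN !size_polyN. Qed.

End Bidegree.

(** * The combinatorial obstruction *)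

Lemma intr_eq0_pchar0 (k : fieldType) (pchar0 : [pchar k] =i pred0) (a : int) :
  a%:~R = 0 :> k -> a = 0.
Proof.
have H := (pcharf0P k).1 pchar0.
case: a => [a /eqP|a /eqP]; first by rewrite [_ == _]H => /eqP ->.
by rewrite NegzE mulrNz oppr_eq0 [_ == _]H.
Qed.

Section NoToricLND.
Variables (n d m e : nat).
Hypotheses (n_ge2 : (2 <= n)%N) (d_ge2 : (2 <= d)%N).
Hypotheses (m_ge1 : (1 <= m)%N) (e_ge1 : (1 <= e)%N).

(* [x ^+ xden j] cancels the x-denominator of the elements of R that have
   degree j in s. *)
Definition xden (j : nat) : nat := (n * (j %/ d) + e * (j %/ (d * m)))%N.

Lemma xden_small j : (j < d)%N -> xden j = 0%N.
Proof.
move=> jd; rewrite /xden !divn_small ?muln0 //.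
by apply: leq_trans jd _; rewrite leq_pmulr.
Qed.

Lemma xden_mono i j : (i <= j)%N -> (xden i <= xden j)%N.
Proof. by move=> ij; rewrite leq_add // leq_mul // leq_div2r. Qed.

(** The index is read in mixed radix, with digits [t], [u], [q] standing for the exponents of s, y,
    z; each y costs [n] and each z costs [n * m + e] in the denominator. *)
Lemma xden_index q u t : (u < m)%N -> (t < d)%N ->
  xden (q * (d * m) + u * d + t) = ((n * m + e) * q + n * u)%N.
Proof.
move=> um td; have d0 : (0 < d)%N by lia.
have E : (q * (d * m) + u * d + t = (q * m + u) * d + t)%N by ring.
rewrite /xden divnMA E divnMDl // (divn_small td) addn0 divnMDl //.
by rewrite (divn_small um) addn0; ring.
Qed.

Lemma xden_top : xden (d * m) = (n * m + e)%N.
Proof.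
have := @xden_index 1 0 0; rewrite !muln0 mul0n mul1n !addn0 muln1.
by apply; lia.
Qed.

Lemma xden_pred_top : xden (d * m).-1 = (n * m.-1)%N.
Proof.
have := @xden_index 0 m.-1 d.-1; rewrite !muln0 mul0n !add0n.
have -> : (m.-1 * d + d.-1 = (d * m).-1)%N by nia.
by apply; lia.
Qed.

(** Replacing both floors by exact quotients puts [xden] below a line through the origin, which it
    meets at the multiples of [d * m]. *)
Lemma xden_slope j : (d * m * xden j <= (n * m + e) * j)%N.
Proof.
have jd := leq_trunc_div j d; have jdm := leq_trunc_div j (d * m).
rewrite /xden; set u := (j %/ d)%N in jd *; set v := (j %/ _)%N in jdm *.
have -> : (d * m * (n * u + e * v) = n * m * (u * d) + e * (v * (d * m)))%N.
  by ring.
by rewrite mulnDl leq_add // leq_mul2l ?jd ?jdm orbT.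
Qed.

Lemma xden_succ r : ~~ (d %| r.+1)%N -> xden r.+1 = xden r.
Proof.
move=> ndvd; have ndvd' : ~~ (d * m %| r.+1)%N.
  by apply: contra ndvd; apply: dvdn_trans; rewrite dvdn_mulr.
by rewrite /xden !divnS ?(negPf ndvd) ?(negPf ndvd') //; nia.
Qed.

Lemma xden_round h t : (t < d)%N -> xden (h * d + t) = xden (h * d).
Proof.
move=> td; have d0 : (0 < d)%N by lia.
by rewrite /xden !divnMA divnMDl // divn_small // addn0 mulnK.
Qed.

(** [G] abstracts the set of leading exponents of R. The orbit lengths of x and s become integer
    weights for which the shift has weight -1, while no monomial allowed by [Gdrop] has negative
    weight; comparing these bounds at the exponents of D s and D x gives the contradiction. *)
Lemma no_toric_lnd (k : fieldType) (pchar0 : [pchar k] =i pred0)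
    (G : int -> nat -> Prop) (al be : k) (p : int) (r : nat)
    (l := fun (i : int) (j : nat) => i%:~R * al + j%:R * be) :
  al <> 0 \/ be <> 0 ->
  G 1 0 -> G 0 1 -> G (- (n * m + e)%:Z) (d * m)%N ->
  (forall i j, G i j -> - (xden j)%:Z <= i) ->
  (forall i j, G i j -> l i j <> 0 -> G (i + p) (j + r)%N) ->
  (forall i j, G i j ->
    exists N : nat, G (i + p * N%:Z) (j + r * N)%N /\ l i j + N%:R * l p r = 0) ->
  False.
Proof.
move=> nz Gx Gs Gz Gdrop Gstep Gnil.
have [Nx [Gx' lx]] := Gnil _ _ Gx; have [Ns [_ ls]] := Gnil _ _ Gs.
have [Nz [_ lz]] := Gnil _ _ Gz.
have lxE : l 1 0 = al by rewrite /l mulr0n mul0r addr0 mulr1z mul1r.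
have lsE : l 0 1%N = be by rewrite /l mulr0z mul0r add0r mulr1n mul1r.
rewrite lxE in lx; rewrite lsE in ls.
pose la := - l p r.
have alE : al = Nx%:R * la by rewrite /la mulrN; apply/eqP; rewrite -addr_eq0 lx.
have beE : be = Ns%:R * la by rewrite /la mulrN; apply/eqP; rewrite -addr_eq0 ls.
have la0 : la != 0.
  by apply/eqP => la0; case: nz; rewrite ?alE ?beE la0 mulr0.
(* Up to the non-zero factor [la], the form [l] is the integral weight [i * Nx + j * Ns]. *)
have lE i j : l i j = (i * Nx%:Z + j%:Z * Ns%:Z)%:~R * la.
  by rewrite /l alE beE intrD !intrM mulrDl -!mulrA.
have lE0 i j : l i j = 0 -> i * Nx%:Z + j%:Z * Ns%:Z = 0.
  rewrite lE => /eqP; rewrite mulf_eq0 (negPf la0) orbF => /eqP.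
  exact: intr_eq0_pchar0.
have pr : p * Nx%:Z + r%:Z * Ns%:Z = -1.
  apply/eqP; rewrite -subr_eq0; apply/eqP/(intr_eq0_pchar0 pchar0)/(mulIf la0).
  by rewrite opprK intrD mulrDl -lE mul1r mul0r /la addrN.
have zE : (d * m)%:Z * Ns%:Z = (n * m + e)%:Z * Nx%:Z + Nz%:Z.
  apply/eqP; rewrite -subr_eq0; apply/eqP/(intr_eq0_pchar0 pchar0)/(mulIf la0).
  have : l (- (n * m + e)%:Z) (d * m)%N = Nz%:R * la.
    by rewrite /la mulrN; apply/eqP; rewrite -addr_eq0 lz.
  rewrite lE mul0r => /eqP; rewrite -subr_eq0 -mulrBl => /eqP <-; congr (_ * _).
  by rewrite -[Nz%:R]/((Nz%:Z)%:~R) -intrB; congr (_ %:~R); ring.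
have Nx0 : (0 < Nx)%N.
  rewrite lt0n; apply/eqP => Nx0; move: pr; rewrite Nx0; nia.
have Ns0 : (0 < Ns)%N.
  rewrite lt0n; apply/eqP => Ns0; move: zE; rewrite Ns0; nia.
(* One shift from s and, next, one from x: the exponents of D s and D x. Both starting weights are
   non-zero. *)
have {}Gs : G p r.+1.
  have := Gstep _ _ Gs; rewrite add0r add1n; apply; rewrite lsE beE.
  by apply/eqP; rewrite mulf_neq0 // ((pcharf0P k).1 pchar0); lia.
have {}Gx : G (1 + p) r.
  have := Gstep _ _ Gx; rewrite add0n; apply; rewrite lxE alE.
  by apply/eqP; rewrite mulf_neq0 // ((pcharf0P k).1 pchar0); lia.
(* For [r = 0], [xden 1 = 0] because [d >= 2], so [p >= 0], against [pr]. *)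
have [r0|r0] := posnP r.
  move: (Gdrop _ _ Gs) pr; rewrite r0 xden_small //; nia.
(* The end of the orbit of x has weight zero and still obeys [Gdrop]; with [xden_slope] this
   reverses the inequality contained in [zE], so z has weight zero. *)
have NxNs : (d * m * Ns = (n * m + e) * Nx)%N.
  suff: (d * m * Ns <= (n * m + e) * Nx)%N by move: zE; lia.
  have := Gdrop _ _ Gx'; rewrite add0n => Gr.
  have Gr' : (Ns * r <= xden (r * Nx))%N by move: Gr pr; lia.
  rewrite -(leq_pmul2r r0) -mulnA.
  have := xden_slope (r * Nx); have -> : ((n * m + e) * (r * Nx) =
    (n * m + e) * Nx * r)%N by ring.
  by apply: leq_trans; rewrite leq_mul2l Gr' orbT.
have slope j : (Nx * xden j <= Ns * j)%N.
  have dm0 : (0 < d * m)%N by nia.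
  rewrite -(leq_pmul2l dm0) [leqRHS]mulnA NxNs.
  have -> : (d * m * (Nx * xden j) = d * m * xden j * Nx)%N by ring.
  have -> : ((n * m + e) * Nx * j = (n * m + e) * j * Nx)%N by ring.
  by rewrite leq_mul2r xden_slope orbT.
(* If [d] does not divide [r.+1], then [xden r.+1 = xden r], and [slope r] makes the weight of the
   shift non-negative. *)
have [/dvdnP[h rh]|ndvd] := boolP (d %| r.+1)%N; last first.
  by have := Gdrop _ _ Gs; rewrite xden_succ // => Gr; have := slope r; nia.
have h0 : (0 < h)%N by rewrite lt0n; apply/eqP => h0; move: rh; rewrite h0.
have rE : (r = h.-1 * d + d.-1)%N by nia.
have slr := slope (h.-1 * d)%N.
have := Gdrop _ _ Gx; rewrite {1}rE xden_round; last by lia.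
move=> Gr.
(* This comes from the exponent of D x. On the other side, [n >= 2] and [e >= 1] in [NxNs] give
   [2 * Nx < d * Ns], and [d <= 2 * d.-1] makes the two incompatible. *)
have lt1 : (Ns * d.-1 < Nx)%N.
  have E : (Ns * r = Ns * (h.-1 * d) + Ns * d.-1)%N by rewrite {1}rE; ring.
  by nia.
have : (2 * Nx < d * Ns)%N.
  have : (2 * Nx * m < d * Ns * m)%N by nia.
  by rewrite ltn_pmul2r.
have : (d * Ns <= 2 * (Ns * d.-1))%N by nia.
by lia.
Qed.
End NoToricLND.

(** * Evaluation, derivations and the chain rule *)

Section Eval2.
Variables (k : fieldType) (A : comAlgType k).
Implicit Types (a b : A) (p : {poly k}) (w : {poly {poly k}}).

(* [eval2 w a b] is convertible to [evals a b w]; the latter inherits the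
   ring morphism structure. *)
Definition evals a b : {poly {poly k}} -> A :=
  horner_eval b \o map_poly (horner_alg a).

HB.instance Definition _ a b := GRing.RMorphism.on (evals a b).

Lemma evalsC a b p : evals a b p%:P = horner_alg a p.
Proof. by rewrite /evals /= map_polyC /horner_eval hornerC. Qed.

Lemma evalsX a b : evals a b 'X = b.
Proof. by rewrite /evals /= map_polyX /horner_eval hornerX. Qed.

Lemma evalsB a b : {morph evals a b : v w / v - w}.
Proof. exact: rmorphB. Qed.

Lemma horner_alg_unique (h : {rmorphism {poly k} -> A}) p :
  (forall c, h c%:P = c%:A) -> h p = horner_alg (h 'X) p.
Proof.
move=> hC; elim/poly_ind: p => [|p c IH]; first by rewrite !rmorph0.
by rewrite !rmorphD !rmorphM /= horner_algX horner_algC IH hC.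
Qed.

Lemma derivation_chain (D : A -> A) a b w : derivation D ->
  D (evals a b w) =
  evals a b (map_poly (@deriv k) w) * D a + evals a b w^`() * D b.
Proof.
case=> Dlin DM.
have D0 : D 0 = 0 by have := Dlin (-1) 0 0; rewrite !scaleN1r oppr0 addr0 addNr.
have DD u v : D (u + v) = D u + D v by have := Dlin 1 u v; rewrite !scale1r.
have DZ c u : D (c *: u) = c *: D u by have := Dlin c u 0; rewrite !addr0 D0 addr0.
have D1 : D 1 = 0.
  have := DM 1 1; rewrite !mul1r mulr1 => /eqP.
  by rewrite -subr_eq0 opprD addNKr oppr_eq0 => /eqP.
have Dp p : D (horner_alg a p) = horner_alg a p^`() * D a.
  elim/poly_ind: p => [|p c IH]; first by rewrite !linear0 mul0r D0.
  rewrite derivD derivM derivX derivC mulr1 addr0 !rmorphD !rmorphM /=.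
  rewrite horner_algX horner_algC DD DZ D1 scaler0 addr0 DM IH; ring.
elim/poly_ind: w => [|w p IH].
  by rewrite map_poly0 linear0 !rmorph0 !mul0r addr0 D0.
have -> : map_poly (@deriv k) (w * 'X + p%:P) =
    map_poly (@deriv k) w * 'X + (p^`())%:P.
  apply/polyP => i; rewrite coef_map /= !coefD derivD !coefMX !coefC coef_map.
  by case: i => [|i] /=; rewrite ?derivC ?linear0.
rewrite derivD derivM derivX derivC mulr1 addr0 !rmorphD !rmorphM /=.
rewrite !evalsC !evalsX DD DM Dp IH; ring.
Qed.

Lemma derivation_sub (D : A -> A) a b : derivation D -> D (a - b) = D a - D b.
Proof.
by case=> Dlin _; have := Dlin (-1) b a; rewrite !scaleN1r ![- _ + _]addrC.
Qed.

Lemma derivation_expr0 (D : A -> A) a N : derivation D -> D a = 0 ->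
  D (a ^+ N) = 0.
Proof.
move=> derD Da; have := derivation_chain a 0 ('X^N)%:P derD.
rewrite evalsC rmorphXn /= horner_algX => ->.
by rewrite Da mulr0 derivC rmorph0 mul0r addr0.
Qed.

(** The two products of partial derivatives cancel. This holds in any algebra, so it serves both in
    the polynomial ring and in its quotient. *)
Lemma derivation_slope (P Q : {poly {poly k}}) (n e : nat) (x y z : A)
    (s := evals x y Q - x ^+ e * z) (D : A -> A) :
  derivation D -> D x = 0 -> D y = x ^+ e * evals x s P^`() ->
  D z = evals x y Q^`() * evals x s P^`() - x ^+ n -> D s = x ^+ (n + e).
Proof.
move=> derD Dx Dy Dz; rewrite {1}/s derivation_sub // derivation_chain // Dx mulr0.
rewrite (derivation_leibniz derD) derivation_expr0 // Dy Dz mul0r !add0r exprD.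
ring.
Qed.

Lemma evals_monic a b w N : w \is monic -> size w = N.+1 ->
  evals a b w = b ^+ N + \sum_(i < N) horner_alg a w`_i * b ^+ i.
Proof.
move=> /monicP wm sw; rewrite /evals /= /horner_eval.
rewrite (@horner_coef_wide _ N.+1); last by rewrite -sw size_poly.
rewrite big_ord_recr /= addrC coef_map /=.
have -> : w`_N = 1 by rewrite -wm lead_coefE sw.
rewrite rmorph1 mul1r; congr (_ + _).
by apply: eq_bigr => i _; rewrite coef_map.
Qed.

End Eval2.

Lemma evals_rmorph (k : fieldType) (A B : comAlgType k) (h : {rmorphism A -> B})
    (a b : A) w : (forall c, h c%:A = c%:A) ->
  h (evals a b w) = evals (h a) (h b) w.
Proof.
move=> hA; rewrite /evals /= /horner_eval -horner_map -map_poly_comp.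
congr _.[_]; apply: eq_map_poly => p /=.
have := @horner_alg_unique _ _ (h \o horner_alg a) p; rewrite /= horner_algX.
by apply=> c; rewrite horner_algC hA.
Qed.

(** * Vanishing criteria for polynomials in characteristic zero *)

Section PolyChar0.
Variables (k : fieldType) (pchar0 : [pchar k] =i pred0).

Lemma natr_neq0 i : (i.+1)%:R != 0 :> k.
Proof. by rewrite ((pcharf0P k).1 pchar0). Qed.

(** The integers 1, ..., [size p] are distinct non-zero roots, too many for a non-zero [p]. Leaving
    out [c = 0] allows evaluation at points where x is invertible. *)
Lemma poly_eq0_pchar0 (p : {poly k}) :
  (forall c, c != 0 -> p.[c] = 0) -> p = 0.
Proof.
move=> pc; apply/eqP; apply: contraT => p0.
pose rs : seq k := [seq i.+1%:R | i <- iota 0 (size p)].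
have /(_ rs) := max_poly_roots p0; rewrite size_map size_iota ltnn; apply.
  apply/allP => _ /mapP[i _ ->]; apply/rootP/pc; exact: natr_neq0.
rewrite map_inj_uniq ?iota_uniq // => i j; wlog le_ij : i j / (i <= j)%N.
  by move=> H; case: (leqP i j) => [/H//|/ltnW/H + /esym] => /[apply].
move=> /eqP; rewrite eq_sym -subr_eq0 -natrB ?ltnS // subSS.
by rewrite ((pcharf0P k).1 pchar0) subn_eq0 => ji; apply/eqP; rewrite eqn_leq le_ij.
Qed.

Lemma poly2_eq0_pchar0 (w : {poly {poly k}}) :
  (forall a b, a != 0 -> (map_poly (horner_eval a) w).[b] = 0) -> w = 0.
Proof.
move=> wab; apply/polyP => j; rewrite coef0; apply: poly_eq0_pchar0 => a a0.
have /polyP/(_ j) : map_poly (horner_eval a) w = 0.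
  by apply: poly_eq0_pchar0 => b _; apply: wab.
by rewrite coef_map coef0.
Qed.

Lemma deriv_eq0_pchar0 (w : {poly {poly k}}) : w^`() = 0 -> w = (w`_0)%:P.
Proof.
move=> w'; apply/polyP => -[|i]; rewrite coefC //=.
have /polyP/(_ i)/polyP/(_ _) := w'; rewrite coef_deriv => H.
apply/polyP => l; have := H l; rewrite coefMn !coef0 => /eqP.
by rewrite -mulr_natr mulf_eq0 (negPf (natr_neq0 i)) orbF => /eqP.
Qed.

End PolyChar0.

(** * Locally nilpotent derivations of the surface *)

Section Surface.
Variables (k : fieldType) (pchar0 : [pchar k] =i pred0).
Variables (n d m e : nat).
Hypotheses (n_ge2 : (2 <= n)%N) (d_ge2 : (2 <= d)%N).
Hypotheses (m_ge1 : (1 <= m)%N) (e_ge1 : (1 <= e)%N).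
Variables (P Q : {poly {poly k}}).
Hypotheses (P_monic : P \is monic) (P_size : size P = d.+1).
Hypotheses (Q_monic : Q \is monic) (Q_size : size Q = m.+1).
Variables (B : comAlgType k) (x y z : B).
Let s : B := evals x y Q - x ^+ e * z.
Local Notation ev := (evals x s).
Local Notation cst := (horner_alg x).
Local Notation xden := (xden n d m e).
(** The surface enters only through three facts: its relation, generation by [x], [y], [z], and the
    algebraic independence of [x] and [s]. *)
Hypothesis relB : x ^+ n * y = ev P.
Hypothesis genB : forall S : B -> Prop, S 1 ->
  (forall u v, S u -> S v -> S (u + v)) -> (forall c u, S u -> S (c *: u)) ->
  (forall u, S u -> [/\ S (x * u), S (y * u) & S (z * u)]) -> forall u, S u.
Hypothesis ev_inj : forall w, ev w = 0 -> w = 0.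

Implicit Types (u v : B) (w : {poly {poly k}}) (p : {poly k}).

Let d_gt0 : (0 < d)%N. Proof. exact: ltnW. Qed.
Let dm_gt0 : (0 < d * m)%N. Proof. by rewrite muln_gt0 d_gt0. Qed.

(** * A spanning family over k[x] *)

(** The exponents are the mixed-radix digits of [j]: since z, y, s have degrees [d * m], [d], 1 in
    s, the index is the degree. *)
Definition basis (j : nat) : B :=
  z ^+ (j %/ (d * m)) * y ^+ ((j %/ d) %% m) * s ^+ (j %% d).

Definition spanned (u : B) : Prop :=
  exists (N : nat) (c : nat -> {poly k}), u = \sum_(j < N) cst (c j) * basis j.

Lemma spanned0 : spanned 0.
Proof. by exists 0%N, (fun=> 0); rewrite big_ord0. Qed.

Lemma spannedD u v : spanned u -> spanned v -> spanned (u + v).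
Proof.
have widen N N' (c : nat -> {poly k}) : (N <= N')%N ->
    \sum_(j < N) cst (c j) * basis j =
    \sum_(j < N') cst (if (j < N)%N then c j else 0) * basis j.
  move=> le; rewrite (big_ord_widen _ (fun j => cst (c j) * basis j) le) big_mkcond.
  by apply: eq_bigr => j _; case: ifP => //; rewrite rmorph0 mul0r.
move=> [N [c ->]] [N' [c' ->]].
rewrite (widen N (maxn N N')) ?leq_maxl // (widen N' (maxn N N')) ?leq_maxr //.
rewrite -big_split /=; exists (maxn N N').
exists (fun j => (if (j < N)%N then c j else 0) + (if (j < N')%N then c' j else 0)).
by apply: eq_bigr => j _; rewrite rmorphD mulrDl.
Qed.

Lemma spannedZ p u : spanned u -> spanned (cst p * u).
Proof.
move=> [N [c ->]]; exists N, (fun j => p * c j).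
by rewrite mulr_sumr; apply: eq_bigr => j _; rewrite rmorphM mulrA.
Qed.

Lemma spannedN u : spanned u -> spanned (- u).
Proof.
by move=> /(spannedZ (-1)); rewrite rmorphN rmorph1 mulN1r.
Qed.

Lemma spanned_sum (I : Type) (r : seq I) (A : pred I) (F : I -> B) :
  (forall i, A i -> spanned (F i)) -> spanned (\sum_(i <- r | A i) F i).
Proof.
by move=> SF; apply: big_rec => [|i u Ai Su]; [exact: spanned0 | apply: spannedD; auto].
Qed.

Lemma cstXn N : cst 'X^N = x ^+ N.
Proof. by rewrite rmorphXn /= horner_algX. Qed.

Lemma spannedXn N u : spanned u -> spanned (x ^+ N * u).
Proof. by rewrite -cstXn; exact: spannedZ. Qed.

Lemma spanned_mon q (u t : nat) : (u < m)%N -> (t < d)%N ->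
  spanned (z ^+ q * y ^+ u * s ^+ t).
Proof.
move=> um td; pose i := (q * (d * m) + u * d + t)%N.
have E : i = ((q * m + u) * d + t)%N by rewrite /i; ring.
have -> : z ^+ q * y ^+ u * s ^+ t = basis i.
  rewrite /basis divnMA E divnMDl // (divn_small td) addn0 divnMDl //.
  by rewrite (divn_small um) addn0 !modnMDl !modn_small.
exists i.+1, (fun j => if j == i then 1 else 0).
rewrite big_ord_recr /= eqxx rmorph1 mul1r big1 ?add0r // => j _.
by rewrite ltn_eqF // rmorph0 mul0r.
Qed.

Lemma y_pow_m : y ^+ m = s + x ^+ e * z - \sum_(i < m) cst Q`_i * y ^+ i.
Proof. by rewrite /s subrK (evals_monic _ _ Q_monic Q_size) addrK. Qed.

Lemma s_pow_d : s ^+ d = x ^+ n * y - \sum_(i < d) cst P`_i * s ^+ i.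
Proof. by rewrite relB (evals_monic _ _ P_monic P_size) addrK. Qed.

(** Reducing [y ^+ m] gives [z ^+ q * s ^+ t.+1], [z ^+ q.+1 * s ^+ t] and lower powers of y. Only
    the first can leave the family, when [t.+1 = d], hence the premise. *)
Lemma spanned_top_step q t : spanned (z ^+ q * s ^+ t.+1) -> (t < d)%N ->
  spanned (z ^+ q * y ^+ m * s ^+ t).
Proof.
move=> Ss td; rewrite y_pow_m mulrBr mulrDr !mulrBl mulrDl.
apply: spannedD; first apply: spannedD.
- by rewrite -mulrA -exprS.
- rewrite mulrCA -mulrA; apply: spannedXn; rewrite -exprSr.
  by have := @spanned_mon q.+1 0 t m_ge1 td; rewrite expr0 mulr1.
apply: spannedN; rewrite mulr_sumr mulr_suml; apply: spanned_sum => i _.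
rewrite mulrCA -mulrA; apply: spannedZ; exact: spanned_mon.
Qed.

Lemma spanned_zs q t : (t <= d)%N -> spanned (z ^+ q * s ^+ t).
Proof.
have zs t' : (t' < d)%N -> spanned (z ^+ q * s ^+ t').
  by move=> td; have := @spanned_mon q 0 t' m_ge1 td; rewrite expr0 mulr1.
rewrite leq_eqVlt => /orP[/eqP->|/zs//].
rewrite s_pow_d mulrBr; apply: spannedD; last first.
  apply: spannedN; rewrite mulr_sumr; apply: spanned_sum => i _.
  by rewrite mulrCA; apply: spannedZ; apply: zs.
rewrite mulrCA; apply: spannedXn.
case: (ltnP 1 m) => m1.
  by have := @spanned_mon q 1 0 m1 d_gt0; rewrite expr0 mulr1 expr1.
(* For [m = 1] the y produced by reducing [s ^+ d] must be reduced in turn; this leads to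
   [z ^+ q * s], a member of the family because [d >= 2]. *)
have m1' : m = 1%N by apply/eqP; rewrite eqn_leq m1.
have := @spanned_top_step q 0 _ d_gt0; rewrite expr0 mulr1 m1' expr1.
by apply; have := zs 1%N d_ge2; rewrite expr1.
Qed.

Lemma spannedP u : spanned u.
Proof.
have S1 : spanned 1.
  by have := @spanned_mon 0 0 0 m_ge1 d_gt0; rewrite !expr0 !mulr1.
apply: genB => //; first exact: spannedD.
  move=> c {}u Su; have <- : cst c%:P * u = c *: u.
    by rewrite horner_algC -scalerAl mul1r.
  exact: spannedZ.
move=> {}u Su; split.
- by have := spannedXn 1 Su; rewrite expr1.
- case: Su => N [c ->]; rewrite mulr_sumr; apply: spanned_sum => j _.
  rewrite mulrCA; apply: spannedZ; rewrite /basis mulrA mulrCA.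
  rewrite -exprS; have := ltn_pmod (j %/ d) m_ge1.
  (* Multiplication by [y] overflows the middle digit exactly when that digit is [m.-1]. *)
  rewrite leq_eqVlt => /orP[/eqP->|um]; last by apply: spanned_mon; rewrite ?ltn_pmod.
  by apply: spanned_top_step; [apply: spanned_zs|]; rewrite ltn_pmod.
case: Su => N [c ->]; rewrite mulr_sumr; apply: spanned_sum => j _.
rewrite mulrCA; apply: spannedZ; rewrite /basis 2!mulrA -exprS.
by apply: spanned_mon; rewrite ltn_pmod.
Qed.

(** * Numerators and denominators with respect to k[x, s] *)

(** This is [x ^+ (n * m) * (Q(x, y) - s)] with y replaced by [P(x, s) / x ^+ n] and denominators
    cleared. *)
Definition z_num : {poly {poly k}} :=
  P ^+ m + (\sum_(i < m) (Q`_i * 'X^(n * (m - i)))%:P * P ^+ i - ('X^(n * m))%:P * 'X).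

Lemma evC p : ev p%:P = cst p. Proof. exact: evalsC. Qed.
Lemma evX : ev 'X = s. Proof. exact: evalsX. Qed.

Lemma z_numE : x ^+ (n * m + e) * z = ev z_num.
Proof.
have -> : x ^+ (n * m + e) * z = x ^+ (n * m) * (evals x y Q - s).
  by rewrite /s opprB addrC subrK exprD mulrA.
have Pi i : ev (P ^+ i) = x ^+ (n * i) * y ^+ i.
  by rewrite rmorphXn /= -relB exprMn exprM.
rewrite (evals_monic _ _ Q_monic Q_size) /z_num [ev _]rmorphD /= Pi evalsB /=.
rewrite [ev (\sum_(i < m) _)]rmorph_sum /= [ev (_ * 'X)]rmorphM /= evX.
rewrite [ev _%:P]evC cstXn.
rewrite mulrBr mulrDr -addrA; congr (_ + (_ - _)).
rewrite mulr_sumr; apply: eq_bigr => i _; rewrite rmorphM /= Pi evC.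
rewrite rmorphM /= cstXn !mulrA -[_ * x ^+ _ * x ^+ _]mulrA -exprD -mulnDr.
by rewrite subnK 1?ltnW // [cst _ * _]mulrC.
Qed.

Lemma P_exp_size i : size (P ^+ i) = (d * i).+1.
Proof.
rewrite -[LHS]prednK ?size_exp ?P_size // size_poly_gt0.
by rewrite monic_neq0 // monic_exp.
Qed.

(** The powers [P ^+ i] with [i < m] have degree [d * i < d * m], and the linear term has degree
    [1 < d * m] because [d >= 2]. *)
Lemma z_num_rest_size : (size (z_num - P ^+ m)%R <= d * m)%N.
Proof.
rewrite /z_num addrC addKr; apply: leq_trans (size_polyD _ _) _.
rewrite geq_max size_polyN; apply/andP; split.
  apply: (leq_trans (size_sum _ _ _)); apply/bigmax_leqP => i _.
  rewrite mul_polyC; apply: leq_trans (size_scale_leq _ _) _.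
  by rewrite P_exp_size ltn_mul2l d_gt0 /=.
rewrite mul_polyC; apply: leq_trans (size_scale_leq _ _) _.
by rewrite size_polyX; nia.
Qed.

Lemma z_num_size : size z_num = (d * m).+1.
Proof.
rewrite -[z_num](subrK (P ^+ m)) addrC size_polyDl P_exp_size //.
by rewrite ltnS z_num_rest_size.
Qed.

Lemma z_num_monic : z_num \is monic.
Proof.
rewrite monicE -[z_num](subrK (P ^+ m)) addrC lead_coefDl.
  by rewrite -monicE monic_exp.
by rewrite P_exp_size ltnS z_num_rest_size.
Qed.

Definition basis_num (j : nat) : {poly {poly k}} :=
  z_num ^+ (j %/ (d * m)) * P ^+ ((j %/ d) %% m) * 'X^(j %% d).

Lemma basis_numE j : x ^+ xden j * basis j = ev (basis_num j).
Proof.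
rewrite /basis_num !rmorphM !rmorphXn /= evX -relB -z_numE !exprMn -!exprM.
have := @xden_index n d m e n_ge2 d_ge2 m_ge1 e_ge1
  (j %/ (d * m)) ((j %/ d) %% m) (j %% d).
have -> : (j %/ (d * m) * (d * m) + (j %/ d) %% m * d + j %% d = j)%N.
  by rewrite divnMA [(d * m)%N]mulnC mulnA -mulnDl -!divn_eq.
rewrite !ltn_pmod // => -> //.
by rewrite exprD /basis; ring.
Qed.

Lemma basis_num_size j : size (basis_num j) = j.+1.
Proof.
rewrite /basis_num size_Mmonic ?monicXn //; last first.
  by rewrite monic_neq0 // !(rpredM, rpredX) ?z_num_monic.
rewrite size_polyXn size_Mmonic ?rpredX //; last first.
  by rewrite monic_neq0 // rpredX // z_num_monic.
have -> : size (z_num ^+ (j %/ (d * m))) = (d * m * (j %/ (d * m))).+1.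
  rewrite -[LHS]prednK ?size_exp ?z_num_size // size_poly_gt0.
  by rewrite monic_neq0 // monic_exp // z_num_monic.
have E1 := divn_eq j d; have E2 := divn_eq (j %/ d) m.
rewrite P_exp_size !addnS /= divnMA [in RHS]E1 [in RHS]E2; ring.
Qed.

(* The basis elements have pairwise distinct degrees in s, so that the leading
   terms of a combination of them cannot cancel. *)
Lemma numerator (u : B) : u <> 0 ->
  exists2 w : {poly {poly k}}, w <> 0 & x ^+ xden (size w).-1 * u = ev w.
Proof.
case: (spannedP u) => N [c ->]; elim: N => [|N IH]; first by rewrite big_ord0.
(* Vanishing top coefficients are removed by induction, so that [N] becomes the degree of the
   numerator. *)
have [c0|c0] := eqVneq (c N) 0.
  by rewrite big_ord_recr /= c0 rmorph0 mul0r addr0.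
(* All terms are brought to the denominator [x ^+ xden N], the largest one by [xden_mono]. *)
move=> _; pose w :=
  \sum_(j < N.+1) (c j * 'X^(xden N - xden j))%:P * basis_num j.
have sw : size w = N.+1.
  rewrite /w big_ord_recr /= subnn mulr1 addrC mul_polyC.
  have sN : size (c N *: basis_num N) = N.+1 by rewrite size_scale ?basis_num_size.
  rewrite size_polyDl sN // ltnS; apply: (leq_trans (size_sum _ _ _)).
  apply/bigmax_leqP => i _; rewrite mul_polyC.
  by apply: leq_trans (size_scale_leq _ _) _; rewrite basis_num_size.
exists w; first by move=> w0; move: sw; rewrite w0 size_poly0.
rewrite sw /w rmorph_sum mulr_sumr; apply: eq_bigr => j _.
rewrite rmorphM /= -basis_numE evC rmorphM /= cstXn.
have jN : (xden j <= xden N)%N by apply: xden_mono; rewrite -ltnS.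
by rewrite -[in LHS](subnK jN) exprD; ring.
Qed.

Lemma x_exp u : exists N w, x ^+ N * u = ev w.
Proof.
have [->|/eqP /numerator[w _ uw]] := eqVneq u 0.
  by exists 0%N, 0; rewrite mulr0 rmorph0.
by exists (xden (size w).-1), w.
Qed.

(** * Integrality and cancellation *)

Lemma ev_neq0 (w : {poly {poly k}}) : w <> 0 -> ev w <> 0.
Proof. by move=> w0 /ev_inj. Qed.

Lemma ev_injective : injective ev.
Proof.
move=> w w' eqw; apply/eqP; rewrite -subr_eq0; apply/eqP/ev_inj.
by rewrite evalsB eqw subrr.
Qed.

(** Non-zero elements have non-zero numerators, whose product is non-zero in the domain k[X][S]. *)
Lemma mulB_eq0 u v : u * v = 0 -> u = 0 \/ v = 0.
Proof.
move=> uv; apply: contrapT => /not_orP[/numerator[w w0 uw] /numerator[w' w'0 vw]].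
have /ev_inj/eqP : ev (w * w') = 0 by rewrite rmorphM /= -uw -vw mulrACA uv mulr0.
by rewrite mulf_eq0 => /orP[] /eqP.
Qed.

Lemma x_neq0 : x <> 0.
Proof.
have <- : ev 'X%:P = x by rewrite evC horner_algX.
by apply: ev_neq0 => /eqP; rewrite polyC_eq0 polyX_eq0.
Qed.

Lemma mulIB u v v' : u <> 0 -> u * v = u * v' -> v = v'.
Proof.
move=> u0 /eqP; rewrite -subr_eq0 -mulrBr => /eqP/mulB_eq0[//|/eqP].
by rewrite subr_eq0 => /eqP.
Qed.

Lemma mulB_neq0 u v : u <> 0 -> v <> 0 -> u * v <> 0.
Proof. by move=> u0 v0 /mulB_eq0[]. Qed.

Lemma expB_neq0 u N : u <> 0 -> u ^+ N <> 0.
Proof.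
move=> u0; elim: N => [|N IH]; last by rewrite exprS; apply: mulB_neq0.
by rewrite expr0; apply/eqP; rewrite oner_eq0.
Qed.

Lemma domainB : domain B.
Proof. by split; [apply/eqP; rewrite oner_eq0 | exact: mulB_eq0]. Qed.

(* (i, j) is the exponent of the leading term of u as an element of
   k[x, 1/x][s], the degree in s being compared first. *)
Definition exponent (u : B) (i : int) (j : nat) : Prop :=
  exists w (I : nat), [/\ bideg w I j, x ^+ xden j * u = ev w & i = I%:Z - (xden j)%:Z].

Lemma exponent_exists u : u <> 0 -> exists i j, exponent u i j.
Proof.
move=> /numerator[w w0 uw]; have [I [J b]] := bideg_exists w0.
exists (I%:Z - (xden J)%:Z), J, w, I; split=> //.
by have [sw _] := bideg_size b; rewrite sw in uw.
Qed.

Lemma exponent_neq0 u i j : exponent u i j -> u <> 0.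
Proof.
move=> [w [I [/bideg_neq0 w0 uw _]]] u0; apply: ev_neq0 w0 _.
by rewrite -uw u0 mulr0.
Qed.

Lemma exponent_x : exponent x 1 0.
Proof.
exists 'X%:P, 1%N; rewrite xden_small // subr0; split=> //.
  by have := @bidegXn k 1; rewrite expr1.
by rewrite mul1r evC horner_algX.
Qed.

Lemma exponent_s : exponent s 0 1.
Proof.
exists 'X, 0%N; rewrite xden_small // subr0; split=> //; first exact: bidegX.
by rewrite mul1r evX.
Qed.

Lemma exponent_z : exponent z (- (n * m + e)%:Z) (d * m)%N.
Proof.
exists z_num, 0%N; rewrite xden_top // sub0r z_numE; split=> //.
exact: bideg_monic z_num_monic z_num_size.
Qed.

(** * Action of a derivation on leading exponents *)

Section Derivation.
Variables (D : B -> B) (derD : derivation D).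

Lemma der_ev w :
  D (ev w) = ev (map_poly (@deriv k) w) * D x + ev w^`() * D s.
Proof. exact: derivation_chain. Qed.

Lemma derM u v : D (u * v) = D u * v + u * D v.
Proof. exact: derivation_leibniz. Qed.

Lemma der_cst p : D (cst p) = cst p^`() * D x.
Proof. by rewrite -!evC der_ev map_polyC derivC rmorph0 mul0r addr0. Qed.

Lemma der_xn N : x * D (x ^+ N) = x ^+ N * D x *+ N.
Proof.
rewrite -{1}cstXn der_cst derivXn rmorphMn /= cstXn mulrCA.
case: N => [|N]; first by rewrite !mulr0n mul0r.
by rewrite mulrnAl exprSr mulrA.
Qed.

Section Exponent.
Variables (N : nat) (A C : {poly {poly k}}).
Hypotheses (DxE : x ^+ N * D x = ev A) (DsE : x ^+ N * D s = ev C).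
Variables (I0 r : nat).
Hypothesis A_le : bideg_le ('X * A) I0 r.+1.
Hypothesis C_le : bideg_le ('X%:P * C) I0 r.+1.

(** This is the linear form l of the overview. The factors ['X] and ['X%:P] compensate for the Euler
    operators, so exponent [r.+1] in S means a shift by [r], and exponent [I0] in x a shift by
    [I0 - N - 1]. *)
Definition lin (i : int) (j : nat) : k :=
  i%:~R * ('X * A)`_r.+1`_I0 + j%:R * ('X%:P * C)`_r.+1`_I0.

(** Multiplying by x s expresses D through the two Euler operators, so the candidate leading
    coefficient of the result is [lin i j] times that of u. *)
Lemma exponent_der u i j : exponent u i j -> lin i j <> 0 ->
  exponent (D u) (i + (I0%:Z - N%:Z - 1)) (j + r)%N.
Proof.
move=> [w [I [bw uw ->]]] lij; have [b c] := bw.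
set a := xden j in uw lij *.
(* The correction [w *+ a] comes from differentiating [x ^+ a]; it turns the eigenvalue [I] into the
   true exponent [I - a]. *)
pose w' := ('X%:P * map_poly (@deriv k) w - w *+ a) * ('X * A) +
  ('X * w^`()) * ('X%:P * C).
have Duw : x ^+ (N + 1 + a) * s * D u = ev w'.
  have E : x ^+ a * D u = D (ev w) - D (x ^+ a) * u by rewrite -uw derM addrC addKr.
  have -> : x ^+ (N + 1 + a) * s * D u = x ^+ N * x * s * (x ^+ a * D u).
    by rewrite !exprD; ring.
  rewrite E mulrBr.
  have -> : x ^+ N * x * s * (D (x ^+ a) * u) = s * ev A * ev w *+ a.
    have -> : x ^+ N * x * s * (D (x ^+ a) * u) =
        x ^+ N * s * u * (x * D (x ^+ a)) by ring.
    by rewrite der_xn -DxE -uw mulrnAr; congr (_ *+ _); ring.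
  rewrite der_ev /w' rmorphD /= !rmorphM /= evalsB rmorphMn !rmorphM /= evX evC.
  by rewrite horner_algX -DxE -DsE -mulr_natr -[ev w *+ a]mulr_natr; ring.
have [bX cX] := bideg_le_eulerX b; have [bS cS] := bideg_le_eulerS b.
have [bw1 cw1] := bideg_leM (bideg_leD bX (bideg_leN (bideg_leMn a b))) A_le.
have [bw2 cw2] := bideg_leM bS C_le.
have bw' : bideg w' (I + I0) (j + r.+1).
  split; first exact: bideg_leD.
  rewrite !coefD cw1 cw2 !coefD !coefN !coefMn cX cS => E; apply: lij.
  apply/eqP; have /eqP c0 := c; rewrite -[_ == _]orFb -(negPf c0) -mulf_eq0.
  have ia : (I%:Z - a%:Z)%:~R = I%:R - a%:R :> k by rewrite intrB.
  by apply/eqP; rewrite -[RHS]E /lin ia -![w`_j`_I *+ _]mulr_natr; ring.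
have Du0 : D u <> 0.
  by move=> Du0; apply: (ev_neq0 (bideg_neq0 bw')); rewrite -Duw Du0 mulr0.
(* D u has a numerator over its own denominator; [Ew] compares it with [w'], and uniqueness of the
   leading monomial yields the exponent. *)
have [i2 [j2 [w2 [I2 [bw2' uw2 i2E]]]]] := exponent_exists Du0.
have Ew : ('X^(N + 1 + a))%:P * 'X * w2 = ('X^(xden j2))%:P * w'.
  apply: ev_injective; rewrite !rmorphM /= evX !evC !cstXn -uw2 -Duw; ring.
have := bidegM (bidegM (bidegXn k (N + 1 + a)) (bidegX k)) bw2'.
rewrite Ew => /(bideg_uniq (bidegM (bidegXn k (xden j2)) bw')) [eI eJ].
have j2E : j2 = (j + r)%N by lia.
exists w2, I2; rewrite -j2E; split=> //; lia.
Qed.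

(** As long as [lin] is non-zero the iterates keep an exponent and stay non-zero, so nilpotence
    forces a zero of [lin] on the orbit. *)
Lemma exponent_iter M u i j : iter M D u = 0 -> exponent u i j ->
  exists L : nat, (exists v, exponent v (i + (I0%:Z - N%:Z - 1) * L%:Z) (j + r * L)%N)
    /\ lin i j + L%:R * lin (I0%:Z - N%:Z - 1) r = 0.
Proof.
elim: M u i j => [u i j /= u0 /exponent_neq0 //|M IH u i j].
rewrite iterSr => DMu uij; have [l0|/eqP l0] := eqVneq (lin i j) 0.
  exists 0%N; rewrite mulr0 muln0 addr0 addn0 l0 mul0r addr0; split=> //.
  by exists u.
have [L [[v vij] lL]] := IH _ _ _ DMu (exponent_der uij l0).
exists L.+1; split.
  by exists v; move: vij; congr exponent; lia.
rewrite -{}lL /lin natrD intrD -natr1; ring.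
Qed.

End Exponent.

Lemma lnd_x_s : (forall u, exists M, iter M D u = 0) ->
  D x = 0 /\ exists c, D s = cst c.
Proof.
move=> nilD.
have [N [A [C [DxE DsE]]]] : exists N A C, x ^+ N * D x = ev A /\ x ^+ N * D s = ev C.
  have [N1 [A1 DxE]] := x_exp (D x); have [N2 [C1 DsE]] := x_exp (D s).
  exists (N1 + N2)%N, (('X^N2)%:P * A1), (('X^N1)%:P * C1).
  by rewrite !rmorphM /= !evC !cstXn -DxE -DsE exprD; split; ring.
have xN0 : x ^+ N <> 0 by apply: expB_neq0; exact: x_neq0.
have A0 : A = 0 -> D x = 0.
  by move=> A0; apply: (mulIB xN0); rewrite DxE A0 rmorph0 mulr0.
have [AC0|/not_andP AC0] := pselect ('X * A = 0 /\ 'X%:P * C = 0).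
  case: AC0 => /eqP; rewrite mulf_eq0 polyX_eq0 /= => /eqP /A0 ->.
  move=> /eqP; rewrite mulf_eq0 polyC_eq0 polyX_eq0 /= => /eqP C0.
  by split=> //; exists 0; apply: (mulIB xN0); rewrite DsE C0 !rmorph0 mulr0.
(* The degree in S at the common leading place is the shift plus one: a successor means a
   non-negative shift, excluded by [no_toric_lnd], and zero means the shift -1. *)
have [I0 [[|r] [A_le C_le top]]] := bideg_exists2 AC0; last first.
  exfalso; pose G i j := exists u, exponent u i j.
  apply: (@no_toric_lnd n d m e n_ge2 d_ge2 m_ge1 e_ge1 k pchar0 G _ _
    (I0%:Z - N%:Z - 1) r top).
  - by exists x; exact: exponent_x.
  - by exists s; exact: exponent_s.
  - by exists z; exact: exponent_z.
  - by move=> i j [u [w [I [_ _ ->]]]]; lia.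
  - by move=> i j [u uij] l0; exists (D u); exact: (exponent_der DxE DsE A_le C_le).
  move=> i j [u uij]; have [M DMu] := nilD u.
  exact: (exponent_iter DxE DsE A_le C_le DMu uij).
(* Here ['X * A] has degree at most 0 in S, which forces [A = 0]. *)
have {}A0 : D x = 0.
  apply: A0; apply/eqP; rewrite -size_poly_eq0; apply: contraLR A_le.1.
  by rewrite -lt0n => sA; rewrite mulrC size_mulX -?size_poly_gt0 // -ltnNge ltnS.
split=> //; have [Ds0|/eqP Ds0] := eqVneq (D s) 0; first by exists 0; rewrite rmorph0.
have [w w0 Dsw] := numerator Ds0.
have E : ('X^N)%:P * w = ('X^(xden (size w).-1))%:P * C.
  by apply: ev_injective; rewrite !rmorphM /= !evC !cstXn -Dsw -DsE; ring.
(* The numerator of D s has the same degree in S as [C], namely 0; since [xden 0 = 0], D s itself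
   lies in k[x]. *)
have sw : (size w <= 1)%N.
  have XN0 M : 'X^M != 0 :> {poly k} by rewrite monic_neq0 ?monicXn.
  move: (congr1 (fun p : {poly {poly k}} => size p) E); rewrite !mul_polyC !size_scale //.
  by move=> ->; have := C_le.1; rewrite mul_polyC size_scale // polyX_eq0.
exists w`_0; move: Dsw; have -> : (size w).-1 = 0%N by move: sw; lia.
by rewrite xden_small // mul1r -evC -size1_polyC.
Qed.

End Derivation.

(** * Derivations that kill x *)

(** Some [x ^+ N * u] lies in k[x, s], where a derivation killing [x] is determined by its value at
    [s]; then [x ^+ N] cancels. *)
Lemma der_multiple (D E : B -> B) p : derivation D -> derivation E ->
  D x = 0 -> E x = 0 -> D s = cst p * E s -> forall u, D u = cst p * E u.
Proof.
move=> derD derE Dx0 Ex0 DEs u; have [N [w uw]] := x_exp u.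
have kill F : derivation F -> F x = 0 -> x ^+ N * F u = ev w^`() * F s.
  move=> derF Fx0; have : F (x ^+ N * u) = ev w^`() * F s.
    by rewrite uw der_ev // Fx0 mulr0 add0r.
  by rewrite derM // -cstXn der_cst // Fx0 mulr0 mul0r add0r.
have xN0 : x ^+ N <> 0 by apply: expB_neq0; exact: x_neq0.
apply: (mulIB xN0).
by rewrite kill // mulrCA kill // DEs mulrCA.
Qed.

(** The numerator of u has zero derivative in S, so in characteristic zero it has degree 0 in S,
    where the denominator is trivial. *)
Lemma kill_s_cst (D : B -> B) : derivation D -> D x = 0 -> D s <> 0 ->
  forall u, D u = 0 -> exists p, u = cst p.
Proof.
move=> derD Dx0 Ds0 u Du0; have [->|/eqP u0] := eqVneq u 0.
  by exists 0; rewrite rmorph0.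
have [w w0 uw] := numerator u0.
have : D (x ^+ xden (size w).-1 * u) = ev w^`() * D s.
  by rewrite uw der_ev // Dx0 mulr0 add0r.
rewrite derM // -cstXn der_cst // Dx0 Du0 !mulr0 mul0r addr0.
move=> /esym/mulB_eq0[/ev_inj/(deriv_eq0_pchar0 pchar0) wE|//].
exists w`_0; move: uw; rewrite wE coefC /= -evC; set q := size _.
have -> : q.-1 = 0%N by rewrite /q size_polyC; case: eqP.
by rewrite xden_small // mul1r.
Qed.

(** On k[x, s] such a D lowers the degree in s, and it commutes with multiplication by [x ^+ N]. *)
Lemma der_nilpotent (D : B -> B) p : derivation D -> D x = 0 -> D s = cst p ->
  is_lnd D.
Proof.
move=> derD Dx0 Ds; split=> // u; have [N [w uw]] := x_exp u.
have Dev w1 : D (ev w1) = ev (w1^`() * p%:P).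
  by rewrite der_ev // Dx0 mulr0 add0r Ds rmorphM /= evC.
have nil M w1 : (size w1 <= M)%N -> iter M D (ev w1) = 0.
  elim: M w1 => [|M IH] w1 sw1 /=.
    by rewrite size_poly_leq0 in sw1; rewrite (eqP sw1) rmorph0.
  rewrite -iterS iterSr Dev IH // mulrC mul_polyC.
  apply: leq_trans (size_scale_leq _ _) _.
  have [->|w10] := eqVneq w1 0; first by rewrite linear0 size_poly0.
  by rewrite -ltnS; apply: leq_trans (lt_size_deriv w10) sw1.
have xN0 : x ^+ N <> 0 by apply: expB_neq0; exact: x_neq0.
exists (size w); apply: (mulIB xN0).
rewrite mulr0 -(nil _ w (leqnn _)) -uw; elim: (size w) => //= M <-.
by rewrite derM // -cstXn der_cst // Dx0 mulr0 mul0r add0r.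
Qed.

(* The coefficient of the leading term of [D z] forces [x ^+ (n + e)] to
   divide [D s]. *)
Lemma x_dvd_Ds (D : B -> B) c : derivation D -> D x = 0 -> D s = cst c ->
  exists p, c = 'X^(n + e) * p.
Proof.
move=> derD Dx0 Ds; have [->|c0] := eqVneq c 0; first by exists 0; rewrite mulr0.
have Dz : x ^+ (n * m + e) * D z = ev (c%:P * z_num^`()).
  have : D (x ^+ (n * m + e) * z) = ev z_num^`() * D s.
    by rewrite z_numE der_ev // Dx0 mulr0 add0r.
  rewrite derM // -{1}cstXn der_cst // Dx0 mulr0 mul0r add0r => ->.
  by rewrite Ds rmorphM /= evC mulrC.
have topW : z_num^`()`_(d * m).-1 = (d * m)%:R.
  rewrite coef_deriv prednK //.
  have := monicP z_num_monic; rewrite lead_coefE z_num_size /= => ->.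
  by [].
have dmk : (d * m)%:R != 0 :> k by rewrite ((pcharf0P k).1 pchar0) -lt0n.
have sdW : (size z_num^`() <= (d * m).-1.+1)%N.
  rewrite prednK // -ltnS -z_num_size lt_size_deriv //.
  by rewrite monic_neq0 // z_num_monic.
have sW : size z_num^`() = (d * m).-1.+1.
  apply/eqP; rewrite eqn_leq sdW ltnNge; apply/negP => /(nth_default 0).
  rewrite topW => /polyP/(_ 0%N); rewrite -polyC_natr coefC coef0 /=.
  by apply/eqP.
have Dz0 : D z <> 0.
  move=> Dz0; have /ev_inj/eqP : ev (c%:P * z_num^`()) = 0 by rewrite -Dz Dz0 mulr0.
  by rewrite mul_polyC -size_poly_eq0 size_scale // sW.
have [w w0 Dzw] := numerator Dz0.
have E : ('X^(n * m + e))%:P * w = ('X^(xden (size w).-1))%:P * (c%:P * z_num^`()).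
  apply: ev_injective; rewrite !rmorphM /= !evC !cstXn -Dzw mulrCA; congr (_ * _).
  by rewrite Dz rmorphM /= evC.
have XN0 M : 'X^M != 0 :> {poly k} by rewrite monic_neq0 ?monicXn.
have sw : size w = (d * m).-1.+1.
  move: (congr1 (fun p : {poly {poly k}} => size p) E).
  by rewrite !mul_polyC !size_scale // sW.
(* In degree [(d * m).-1] the denominator of D z is only [x ^+ (n * m.-1)], against
   [x ^+ (n * m + e)] in [Dz]; the exponents differ by [n + e]. *)
move: E; rewrite sw /= xden_pred_top //.
move=> /(congr1 (fun p : {poly {poly k}} => p`_(d * m).-1)).
rewrite !coefCM topW => E.
exists ((d * m)%:R^-1 *: w`_(d * m).-1).
have nm : (n * m + e = n * m.-1 + (n + e))%N.
  by rewrite -{1}(prednK m_ge1) mulnS; lia.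
apply: (mulfI (XN0 (n * m.-1)%N)); rewrite mulrA -exprD -nm -scalerAr E.
rewrite -polyC_natr mulrA [_ * (_)%:P]mulrC mul_polyC scalerA mulVf //.
by rewrite scale1r.
Qed.

(** * The Makar-Limanov invariant and rigidity *)

Section Rigidity.
Variable del : B -> B.
Hypotheses (lnd_del : is_lnd del) (del_x : del x = 0) (del_s : del s = x ^+ (n + e)).

Let der_del : derivation del := lnd_derivation lnd_del.

Let del_s_neq0 : del s <> 0.
Proof. by rewrite del_s; apply: expB_neq0; exact: x_neq0. Qed.

Lemma del_nonzero : nonzero del. Proof. by exists s. Qed.

Lemma lnd_form D : is_lnd D -> exists p, forall u, D u = cst p * del u.
Proof.
move=> lndD; have derD := lnd_derivation lndD.
have [Dx0 [c Ds]] := lnd_x_s derD (lnd_nilpotent lndD).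
have [p cE] := x_dvd_Ds derD Dx0 Ds; exists p; apply: der_multiple => //.
by rewrite Ds del_s cE rmorphM /= cstXn mulrC.
Qed.

Lemma iter_multiple D p : (forall u, D u = cst p * del u) ->
  forall i u, iter i D u = cst p ^+ i * iter i del u.
Proof.
move=> DE; elim=> [|i IH] u /=; first by rewrite expr0 mul1r.
rewrite DE IH derM // derivation_expr0 ?der_cst ?del_x ?mulr0 //.
by rewrite mul0r add0r exprS mulrA.
Qed.

Lemma lnd_multiple D p : (forall u, D u = cst p * del u) -> is_lnd D.
Proof.
move=> DE; split; first split.
- move=> c u v; rewrite !DE (derivation_linear der_del).
  by rewrite mulrDr scalerAr.
- by move=> u v; rewrite !DE derM //; ring.
move=> u; have [N delN] := lnd_nilpotent lnd_del u.
by exists N; rewrite (iter_multiple DE) delN mulr0.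
Qed.

(** The kernel of [del] alone is already k[x], and by [lnd_form] every other D kills [x] too. *)
Lemma ML_cst u : ML B u <-> exists p, u = cst p.
Proof.
split=> [/(_ _ lnd_del)|[p ->] D /lnd_form[q DE]]; first exact: kill_s_cst.
by rewrite DE der_cst // del_x !mulr0.
Qed.

(** Iterates of a non-zero D are those of [del] times powers of a non-zero element, so both vanish
    at the same stage. *)
Lemma semi_rigidB : semi_rigid B.
Proof.
split; first exact: domainB.
have zeroE D (lndD : is_lnd D) : nonzero D -> forall i u,
    (iter i D u == 0) = (iter i del u == 0).
  move=> [v Dv] i u; have [p DE] := lnd_form lndD.
  have p0 : cst p <> 0 by move=> p0; apply: Dv; rewrite DE p0 mul0r.
  rewrite (iter_multiple DE); apply/eqP/eqP => [|->]; last by rewrite mulr0.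
  by case/mulB_eq0 => // /(expB_neq0 p0).
move=> D E lndD lndE nzD nzE u; rewrite /lnd_deg; case: eqP => // _.
by congr Some; apply: eq_ex_minn => i; rewrite (zeroE D) ?(zeroE E).
Qed.

Lemma almost_rigidB : almost_rigid B.
Proof.
split; first exact: domainB.
exists del; split=> //; first exact: del_nonzero.
move=> D; split=> [/lnd_form[p DE]|[c c0 DE]].
  by exists (cst p); [rewrite der_cst // del_x mulr0 | exact: DE].
have [p cE] := kill_s_cst der_del del_x del_s_neq0 c0.
by apply: (lnd_multiple (p := p)) => u; rewrite -cE; exact: DE.
Qed.

End Rigidity.

End Surface.

(** * The quotient ring *)

Lemma monic_sum_size (A : nzRingType) (N : nat) (c : 'I_N -> A) :
  let p := 'X^N + \sum_(i < N) (c i)%:P * 'X^i in p \is monic /\ size p = N.+1.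
Proof.
move=> p; have le : (size (\sum_(i < N) (c i)%:P * 'X^i)%R < size ('X^N : {poly A}))%N.
  rewrite size_polyXn ltnS; apply: (leq_trans (size_sum _ _ _)).
  apply/bigmax_leqP => i _; rewrite mul_polyC.
  by apply: leq_trans (size_scale_leq _ _) _; rewrite size_polyXn.
by rewrite /p monicE lead_coefDl // lead_coefXn eqxx size_polyDl // size_polyXn.
Qed.

Lemma var3_cases (k : fieldType) (i : 'I_3) :
  [\/ 'X_i = varX k, 'X_i = varY k | 'X_i = varZ k].
Proof.
case: i => [[|[|[|//]]] lt]; [constructor 1 | constructor 2 | constructor 3];
  by congr ('X_[U_(_)]); apply: val_inj.
Qed.

Section Quotient.
Variables (k : fieldType) (pchar0 : [pchar k] =i pred0).
Variables (n e : nat) (P Q : {poly {poly k}}).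
Local Notation R := (quo_ring n e P Q).
Local Notation pi := (quo_pi n e P Q).
Local Notation X := (varX k).
Local Notation Y := (varY k).
Local Notation Z := (varZ k).
Local Notation S := (evals X Y Q - X ^+ e * Z).
Implicit Types (p q : {mpoly k[3]}) (w : {poly {poly k}}) (u : R).

Lemma quo_piP u : exists p, u = pi p.
Proof. by exists (repr u); rewrite /quo_pi reprK. Qed.

Lemma quo_pi_eq p q : pi p = pi q <-> exists r, p - q = r * rel_poly n e P Q.
Proof.
have -> : (exists r, p - q = r * rel_poly n e P Q) <-> p - q \in rel_ideal n e P Q.
  by split=> /asboolP.
by rewrite Quotient.idealrBE; split=> /eqP.
Qed.

Fact quo_pi_zmod : zmod_morphism pi.
Proof.
move=> p q; apply/eqP; rewrite eq_sym subr_eq -quo_piD subrK; exact/eqP.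
Qed.

Fact quo_pi_monoid : monoid_morphism pi.
Proof. by split; [exact: quo_pi1 | exact: quo_piM]. Qed.

HB.instance Definition _ := GRing.isZmodMorphism.Build {mpoly k[3]} R pi quo_pi_zmod.
HB.instance Definition _ := GRing.isMonoidMorphism.Build {mpoly k[3]} R pi quo_pi_monoid.

Lemma quo_piC c : pi c%:A = c%:A.
Proof.
have -> : c%:A = pi c%:MP * 1 :> R by [].
by rewrite alg_mpolyC mulr1.
Qed.

Lemma quo_pi_evals p q w : pi (evals p q w) = evals (pi p) (pi q) w.
Proof. exact: (evals_rmorph _ _ _ quo_piC). Qed.

Lemma quo_pi_slope : pi S = evals (pi X) (pi Y) Q - pi X ^+ e * pi Z.
Proof. by rewrite rmorphB rmorphM rmorphXn /= quo_pi_evals. Qed.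

Lemma quo_rel : pi X ^+ n * pi Y = evals (pi X) (pi S) P.
Proof.
rewrite -quo_pi_evals -rmorphXn -rmorphM; apply/quo_pi_eq.
by exists 1; rewrite mul1r.
Qed.

Lemma quo_gen (T : R -> Prop) : T 1 ->
  (forall u v, T u -> T v -> T (u + v)) -> (forall c u, T u -> T (c *: u)) ->
  (forall u, T u -> [/\ T (pi X * u), T (pi Y * u) & T (pi Z * u)]) ->
  forall u, T u.
Proof.
move=> T1 TD TZ TM u; have [p ->] := quo_piP u.
have T0 : T 0 by rewrite -(scale0r (1 : R)); exact: TZ.
elim/mpolyind: p => [|c mu p _ _ Tp]; first by rewrite rmorph0.
rewrite rmorphD; apply: TD => //=.
rewrite -mul_mpolyC rmorphM /= -[_ * _]/(c *: pi 'X_[mu]); apply: TZ.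
rewrite mpolyXE_id; apply: (big_rec (fun p => T (pi p))) => [|i q _ Tq].
  by rewrite rmorph1.
elim: (mu i) => [|N IH]; first by rewrite expr0 mul1r.
rewrite exprS -mulrA rmorphM /=; move: (_ ^+ N * q) IH => q' /TM[TX TY TZ'].
by case: (var3_cases k i) => ->.
Qed.

(** For [a != 0], solving for y and z gives a point of the surface with x = a and s = b. The ideal
    vanishes there, hence so does [w] at (a, b). *)
Lemma quo_ev_inj w : evals (pi X) (pi S) w = 0 -> w = 0.
Proof.
rewrite -quo_pi_evals -(rmorph0 pi) => /quo_pi_eq[r]; rewrite subr0 => wr.
apply: (poly2_eq0_pchar0 pchar0) => a b a0.
pose y0 := a ^- n * (map_poly (horner_eval a) P).[b].
pose z0 := a ^- e * ((map_poly (horner_eval a) Q).[y0] - b).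
pose v (i : 'I_3) : k := nth 0 [:: a; y0; z0] i.
have vX : X.@[v] = a by rewrite mevalXU.
have vY : Y.@[v] = y0 by rewrite mevalXU.
have vZ : Z.@[v] = z0 by rewrite mevalXU.
have vS : S.@[v] = b.
  rewrite mevalB eval2_meval mevalM rmorphXn /= vX vY vZ /z0 mulVKf ?expf_neq0 //.
  by rewrite opprB addrC subrK.
have := congr1 (meval v) wr; rewrite eval2_meval vX vS => ->.
rewrite mevalM /rel_poly -/S mevalB mevalM rmorphXn /= vX vY eval2_meval vX vS.
by rewrite /y0 mulVKf ?expf_neq0 // subrr mulr0.
Qed.

(** * Construction of the derivation on the quotient *)

Let i1 := @Ordinal 3 1 isT.
Let i2 := @Ordinal 3 2 isT.
Let A : {mpoly k[3]} := X ^+ e * evals X S P^`().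
Let C : {mpoly k[3]} := evals X Y Q^`() * evals X S P^`() - X ^+ n.

Definition pre_partial p : {mpoly k[3]} := mderiv i1 p * A + mderiv i2 p * C.

Lemma pre_partial_derivation : derivation pre_partial.
Proof.
split=> [c p q|p q]; rewrite /pre_partial.
  by rewrite !mderivD !mderivZ !mulrDl scalerDr !scalerAl; ring.
by rewrite !mderivM; ring.
Qed.

Lemma mderiv_var (i j : 'I_3) : mderiv i ('X_j : {mpoly k[3]}) = (j == i)%:R.
Proof.
rewrite mderivX mnm1E; case: eqP => [->|_]; last by rewrite scale0r.
have -> : (U_(i) - U_(i) = 0 :> 'X_{1..3})%MM.
  by apply/mnmP => l; rewrite mnmBE subnn mnm0E.
by rewrite mpolyX0 scale1r.
Qed.

Lemma pre_partialX : pre_partial X = 0.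
Proof. by rewrite /pre_partial !mderiv_var !mul0r addr0. Qed.

Lemma pre_partialY : pre_partial Y = A.
Proof. by rewrite /pre_partial !mderiv_var mul1r mul0r addr0. Qed.

Lemma pre_partialZ : pre_partial Z = C.
Proof. by rewrite /pre_partial !mderiv_var mul1r mul0r add0r. Qed.

(** Both terms of the relation have derivative [X ^+ (n + e)] times the S-derivative of P at (X, S).
    Therefore the ideal is stable and the derivation descends. *)
Lemma pre_partial_rel : pre_partial (rel_poly n e P Q) = 0.
Proof.
have der := pre_partial_derivation.
have -> : rel_poly n e P Q = X ^+ n * Y - evals X S P by [].
have := derivation_slope der pre_partialX pre_partialY pre_partialZ => DS.
rewrite derivation_sub // (derivation_leibniz der) derivation_expr0 ?pre_partialX //.
rewrite derivation_chain // pre_partialX pre_partialY DS /A exprD; ring.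
Qed.

(** The choice of representative is harmless by [partial_pi]. *)
Definition partial u : R := pi (pre_partial (repr u)).

Lemma partial_pi p : partial (pi p) = pi (pre_partial p).
Proof.
have /quo_pi_eq[r pr] : pi p = pi (repr (pi p)) by rewrite /quo_pi reprK.
apply/esym/quo_pi_eq; exists (pre_partial r).
have der := pre_partial_derivation.
by rewrite -derivation_sub // pr (derivation_leibniz der) pre_partial_rel mulr0 addr0.
Qed.

Lemma partial_derivation : derivation partial.
Proof.
have [Dlin DM] := pre_partial_derivation.
split=> [c u v|u v].
  have [p ->] := quo_piP u; have [q ->] := quo_piP v.
  have piZ c' p' : c' *: pi p' = pi (c' *: p').
    by rewrite -mul_mpolyC rmorphM.
  by rewrite piZ -rmorphD !partial_pi Dlin rmorphD /= piZ.
have [p ->] := quo_piP u; have [q ->] := quo_piP v.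
by rewrite -rmorphM !partial_pi DM rmorphD !rmorphM.
Qed.

Lemma partialX : partial (pi X) = 0.
Proof. by rewrite partial_pi pre_partialX rmorph0. Qed.

Lemma partialY : partial (pi Y) = pi X ^+ e * evals (pi X) (pi S) P^`().
Proof. by rewrite partial_pi pre_partialY rmorphM rmorphXn /= quo_pi_evals. Qed.

Lemma partialZ : partial (pi Z) =
  evals (pi X) (pi Y) Q^`() * evals (pi X) (pi S) P^`() - pi X ^+ n.
Proof.
by rewrite partial_pi pre_partialZ rmorphB rmorphM rmorphXn /= !quo_pi_evals.
Qed.

End Quotient.

Theorem theorem5p2 (k : fieldType) (pchar0 : [pchar k] =i pred0)
  (n d m e : nat) (n_ge2 : (2 <= n)%N) (d_ge2 : (2 <= d)%N)
  (m_ge1 : (1 <= m)%N) (e_ge1 : (1 <= e)%N)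
  (f : 'I_d -> {poly k}) (g : 'I_m -> {poly k}) :
  let P : {poly {poly k}} := 'X^d + \sum_(i < d) (f i)%:P * 'X^i in
  let Q : {poly {poly k}} := 'X^m + \sum_(j < m) (g j)%:P * 'X^j in
  let R : comAlgType k := quo_ring n e P Q in
  let x : R := quo_pi n e P Q (varX k) in
  let y : R := quo_pi n e P Q (varY k) in
  let z : R := quo_pi n e P Q (varZ k) in
  let s : R := eval2 Q x y - x ^+ e * z in
  let is_partial (partial : R -> R) : Prop :=
    [/\ is_lnd partial,
        partial x = 0,
        partial y = x ^+ e * eval2 P^`() x s &
        partial z = eval2 Q^`() x y * eval2 P^`() x s - x ^+ n] in
  (exists partial : R -> R, is_partial partial) /\
  forall partial : R -> R, is_partial partial ->
    ((forall a : R, ML R a <-> exists p : {poly k}, a = horner_alg x p) /\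
     semi_rigid R) /\
    ((forall D : R -> R, is_lnd D ->
        exists p : {poly k}, forall a : R, D a = horner_alg x p * partial a) /\
     almost_rigid R).

Proof.
move=> P Q R x y z s is_partial.
have [P_monic P_size] := monic_sum_size f; have [Q_monic Q_size] := monic_sum_size g.
have sE : quo_pi n e P Q (evals (varX k) (varY k) Q - varX k ^+ e * varZ k) = s.
  exact: quo_pi_slope.
have rel : x ^+ n * y = evals x s P by rewrite -sE; exact: quo_rel.
have inj w : evals x s w = 0 -> w = 0 by rewrite -sE; exact: (quo_ev_inj pchar0).
have gen := @quo_gen k n e P Q.
split.
  pose del := @partial k n e P Q.
  have der : derivation del by exact: partial_derivation.
  have del_x : del x = 0 by exact: partialX.
  have del_y : del y = x ^+ e * evals x s P^`() by rewrite -sE; exact: partialY.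
  have del_z : del z = evals x y Q^`() * evals x s P^`() - x ^+ n.
    by rewrite -sE; exact: partialZ.
  have del_s := derivation_slope der del_x del_y del_z.
  exists del; split=> //.
  apply: (der_nilpotent n_ge2 d_ge2 m_ge1 e_ge1 P_monic P_size Q_monic Q_size
    rel gen inj (p := 'X^(n + e)) der del_x).
  by rewrite rmorphXn /= horner_algX.
move=> del [lnd_del del_x del_y del_z].
have del_s := derivation_slope (lnd_derivation lnd_del) del_x del_y del_z.
split; split.
- exact: (ML_cst pchar0 n_ge2 d_ge2 m_ge1 e_ge1 P_monic P_size
    Q_monic Q_size rel gen inj lnd_del del_x del_s).
- exact: (semi_rigidB pchar0 n_ge2 d_ge2 m_ge1 e_ge1 P_monic P_size
    Q_monic Q_size rel gen inj lnd_del del_x del_s).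
- exact: (lnd_form pchar0 n_ge2 d_ge2 m_ge1 e_ge1 P_monic P_size
    Q_monic Q_size rel gen inj lnd_del del_x del_s).
exact: (almost_rigidB pchar0 n_ge2 d_ge2 m_ge1 e_ge1 P_monic P_size
    Q_monic Q_size rel gen inj lnd_del del_x del_s).
Qed.
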